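(* The system $\mathsf{DG}+\mathsf{PF\text{-}TP}_{\exists}+\mathsf{QF\text{-}AC}^{2,0}+\mathsf{MP}$ is inconsistent.
   Context: Work in the language of $\mathsf{E\text{-}HA}^{\omega}$ (Heyting arithmetic in all finite types with the axiom of extensionality $(\mathsf{E})$, i.e. $(\forall \varphi^{\rho\to\tau})(\forall x^{\rho},y^{\rho})[x=_{\rho}y\to\varphi(x)=_{\tau}\varphi(y)]$ for all finite types, where equality at higher types is extensional, defined from $=_0$), extended with a predicate $\mathrm{st}^{\sigma}$ (''is standard'') for every finite type $\sigma$. Write $(\forall^{\mathrm{st}}x)$, $(\exists^{\mathrm{st}}x)$ for quantifiers relativised to $\mathrm{st}$; a formula is internal if it does not involve $\mathrm{st}$. Strong majorizability $\leq^{*}$ is defined by: $x\leq_0^* y$ iff $x\leq_0 y$; $x\leq^*_{\rho\to\sigma}y$ iff $(\forall u)(\forall v\leq^*_{\rho}u)(xu\leq^*_{\sigma}yv\wedge yu\leq^*_{\sigma}yv)$. An object $x$ is monotone if $x\leq^* x$; $\tilde\forall$, $\tilde\exists$ range over monotone objects. The Dinis–Gaspar system $\mathsf{DG}$ is $\mathsf{E\text{-}HA}^{\omega}$ plus: (a) $x=_\sigma y\to(\mathrm{st}(x)\to\mathrm{st}(y))$; (b) $\mathrm{st}^{\sigma}(y)\to(x\leq^*_{\sigma}y\to\mathrm{st}^{\sigma}(x))$; (c) $\mathrm{st}(t)$ for every closed term $t$; (d) $\mathrm{st}(z)\wedge\mathrm{st}(x)\to\mathrm{st}(zx)$; external induction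 $\Phi(0)\wedge(\forall^{\mathrm{st}}n^0)(\Phi(n)\to\Phi(n+1))\to(\forall^{\mathrm{st}}n^0)\Phi(n)$ for any $\Phi$; and the following schemes: monotone choice $(\tilde\forall^{\mathrm{st}}x)(\tilde\exists^{\mathrm{st}}y)\Phi(x,y)\to(\tilde\exists^{\mathrm{st}}f)(\tilde\forall^{\mathrm{st}}x)(\exists y\leq^* f(x))\Phi(x,y)$; realization $(\forall x)(\exists^{\mathrm{st}}y)\Phi(x,y)\to(\tilde\exists^{\mathrm{st}}z)(\forall x)(\exists y\leq^* z)\Phi(x,y)$ (any $\Phi$); idealisation $(\tilde\forall^{\mathrm{st}}z)(\exists x)(\forall y\leq^* z)\phi(x,y)\to(\exists x)(\forall^{\mathrm{st}}y)\phi(x,y)$ ($\phi$ internal); independence of premises $[(\tilde\forall^{\mathrm{st}}x)\phi(x)\to(\tilde\exists^{\mathrm{st}}y)\Psi(y)]\to(\tilde\exists^{\mathrm{st}}z)[(\tilde\forall^{\mathrm{st}}x)\phi(x)\to(\tilde\exists y\leq^* z)\Psi(y)]$ ($\phi$ internal); nonstandard Markov principle $[(\tilde\forall^{\mathrm{st}}x)\phi(x)\to\psi]\to(\tilde\exists^{\mathrm{st}}y)[(\forall x\leq^* y)\phi(x)\to\psi]$ ($\phi,\psi$ internal); majorizability $(\forall^{\mathrm{st}}x)(\exists^{\mathrm{st}}y)(x\leq^* y)$. $\mathsf{PF\text{-}TP}_{\exists}$ (parameter-free Transfer): for every internal formula $\varphi(\underline{x})$ with all free variables shown (no parameters allowed),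 $(\exists\underline{x})\varphi(\underline{x})\to(\exists^{\mathrm{st}}\underline{x})\varphi(\underline{x})$. $\mathsf{QF\text{-}AC}^{2,0}$: for quantifier-free $\varphi$, $(\forall Y^2)(\exists n^0)\varphi(Y,n)\to(\exists\Phi^{2\to0})(\forall Y^2)\varphi(Y,\Phi(Y))$. $\mathsf{MP}$ (Markov's principle): $(\forall f^1)[\neg\neg(\exists n)(f(n)=0)\to(\exists n)(f(n)=0)]$.
   Formalization: In the definition of strong majorizability the printed u and v are swapped; read literally, DG alone is already inconsistent (the identity has no majorant). The Howard–Bezem relation is used instead: for all v and all u ≤* v, xu ≤* yv and yu ≤* yv. *)

(* Defs.v *)
From Stdlib Require Import List.
Import ListNotations.

Set Implicit Arguments.
Unset Strict Implicit.

(* * Finite types and the terms of E-HA^omega *)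

Inductive ty : Type :=
| o : ty
| arr : ty -> ty -> ty.

Declare Scope ha_scope.
Delimit Scope ha_scope with ha.
Open Scope ha_scope.

Notation "s ~> t" := (arr s t) (at level 55, right associativity) : ha_scope.

Fixpoint pure (n : nat) : ty :=
  match n with
  | 0 => o
  | S m => pure m ~> o
  end.

Definition ctx : Type := list ty.

(* Typed de Bruijn indices: terms and formulas are well typed by construction,
   and all their free variables are listed in the context. *)
Inductive var : ctx -> ty -> Type :=
| vz : forall G s, var (s :: G) s
| vs : forall G s t, var G s -> var (t :: G) s.

Arguments vz {G s}.
Arguments vs {G s t} _.

(* Variables, zero, successor, the combinators Pi and Sigma, and the recursors. *)
Inductive tm (G : ctx) : ty -> Type :=
| Var : forall s, var G s -> tm G s
| Zero : tm G o
| Succ : tm G (o ~> o)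
| Pi : forall r t, tm G (r ~> t ~> r)
| Sigma : forall d r t, tm G ((d ~> r ~> t) ~> (d ~> r) ~> d ~> t)
| Rec : forall r, tm G (o ~> r ~> (r ~> o ~> r) ~> r)
| App : forall s t, tm G (s ~> t) -> tm G s -> tm G t.

Arguments Var {G s} _.
Arguments Zero {G}.
Arguments Succ {G}.
Arguments Pi {G} r t.
Arguments Sigma {G} d r t.
Arguments Rec {G} r.
Arguments App {G s t} _ _.

Notation "f @ x" := (App f x) (at level 40, left associativity) : ha_scope.
Notation "#0" := (Var vz) : ha_scope.
Notation "#1" := (Var (vs vz)) : ha_scope.
Notation "#2" := (Var (vs (vs vz))) : ha_scope.

Definition renaming (G D : ctx) : Type := forall s, var G s -> var D s.
Definition substitution (G D : ctx) : Type := forall s, var G s -> tm D s.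

Fixpoint tren G D (f : renaming G D) s (t : tm G s) : tm D s :=
  match t with
  | Var v => Var (f _ v)
  | Zero => Zero
  | Succ => Succ
  | Pi r u => Pi r u
  | Sigma d r u => Sigma d r u
  | Rec r => Rec r
  | App a b => App (tren f a) (tren f b)
  end.

Definition twk G r s (t : tm G s) : tm (r :: G) s :=
  tren (fun _ v => vs v) t.

Definition tclosed G s (t : tm [] s) : tm G s :=
  tren (fun u (v : var [] u) => match v with end) t.

Fixpoint tsub G D (f : substitution G D) s (t : tm G s) : tm D s :=
  match t with
  | Var v => f _ v
  | Zero => Zero
  | Succ => Succ
  | Pi r u => Pi r u
  | Sigma d r u => Sigma d r u
  | Rec r => Rec r
  | App a b => App (tsub f a) (tsub f b)
  end.

Definition scons G D r (t : tm D r) (f : substitution G D) :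
    substitution (r :: G) D :=
  fun s v =>
    match v in var G' s' return
      match G' with
      | [] => unit
      | r' :: G0 => tm D r' -> substitution G0 D -> tm D s'
      end
    with
    | vz => fun t _ => t
    | vs w => fun _ f => f _ w
    end t f.

Arguments scons {G D r} t f s _.

Definition sid G : substitution G G := fun _ v => Var v.

Arguments sid {G} s _.

Definition sshift G D r (f : substitution G D) : substitution G (r :: D) :=
  fun _ v => twk r (f _ v).

Arguments sshift {G D r} f s _.

Definition sup G D r (f : substitution G D) : substitution (r :: G) (r :: D) :=
  scons #0 (sshift f).

Arguments sup {G D r} f s _.

(* * Formulas of the language extended with the predicates st *)

Inductive fm (G : ctx) : Type :=
| Bot : fm G
| Eq0 : tm G o -> tm G o -> fm G
| St : forall s, tm G s -> fm G
| And : fm G -> fm G -> fm G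
| Or : fm G -> fm G -> fm G
| Imp : fm G -> fm G -> fm G
| All : forall s, fm (s :: G) -> fm G
| Ex : forall s, fm (s :: G) -> fm G.

Arguments Bot {G}.
Arguments All {G} s _.
Arguments Ex {G} s _.

Notation "A ∧ B" := (And A B) (at level 80, right associativity) : ha_scope.
Notation "A ∨ B" := (Or A B) (at level 85, right associativity) : ha_scope.
Notation "A ⇒ B" := (Imp A B) (at level 90, right associativity) : ha_scope.

Definition Neg G (A : fm G) : fm G := A ⇒ Bot.

Fixpoint fsub G D (f : substitution G D) (A : fm G) : fm D :=
  match A with
  | Bot => Bot
  | Eq0 a b => Eq0 (tsub f a) (tsub f b)
  | St a => St (tsub f a)
  | And B C => fsub f B ∧ fsub f C
  | Or B C => fsub f B ∨ fsub f C
  | Imp B C => fsub f B ⇒ fsub f C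
  | All s B => All s (fsub (sup f) B)
  | Ex s B => Ex s (fsub (sup f) B)
  end.

Definition fwk G r (A : fm G) : fm (r :: G) := fsub (sshift sid) A.

Definition finst G r (t : tm G r) (A : fm (r :: G)) : fm G :=
  fsub (scons t sid) A.

Definition fclosed G (A : fm []) : fm G :=
  fsub (fun u (v : var [] u) => match v with end) A.

(* [fins1 A], [fins2 A]: insert a fresh variable below the last one,
   respectively the last two, variables of the context. *)
Definition fins1 G a r (A : fm (a :: G)) : fm (a :: r :: G) :=
  fsub (sup (sshift sid)) A.

Definition fins2 G b a r (A : fm (b :: a :: G)) : fm (b :: a :: r :: G) :=
  fsub (sup (sup (sshift sid))) A.

Fixpoint internal G (A : fm G) : bool :=
  match A with
  | Bot | Eq0 _ _ => true
  | St _ => false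
  | And B C | Or B C | Imp B C => andb (internal B) (internal C)
  | All _ B | Ex _ B => internal B
  end.

(* Quantifier-free formulas of the language of E-HA^omega, hence without [St]. *)
Fixpoint quantifier_free G (A : fm G) : bool :=
  match A with
  | Bot | Eq0 _ _ => true
  | And B C | Or B C | Imp B C => andb (quantifier_free B) (quantifier_free C)
  | St _ | All _ _ | Ex _ _ => false
  end.

(* * Defined relations *)

Fixpoint Eq s : forall G, tm G s -> tm G s -> fm G :=
  match s with
  | o => fun G x y => Eq0 x y
  | r ~> t => fun G x y => All r (Eq (twk r x @ #0) (twk r y @ #0))
  end.

(* The predecessor x |-> R x 0 (fun u v => v), in combinators. *)
Definition pred_tm {G} : tm G (o ~> o) :=
  Sigma o (o ~> o ~> o) o
    @ (Sigma o o ((o ~> o ~> o) ~> o) @ Rec o @ (Pi o o @ Zero))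
    @ (Pi (o ~> o ~> o) o
         @ (Pi (o ~> o) o @ (Sigma o (o ~> o) o @ Pi o (o ~> o) @ Pi o o))).

(* Truncated subtraction x - y = R y x (fun u v => pred u). *)
Definition monus G (x y : tm G o) : tm G o :=
  Rec o @ y @ x
    @ (Sigma o o (o ~> o) @ (Pi (o ~> o ~> o) o @ Pi o o) @ pred_tm).

Definition Le0 G (x y : tm G o) : fm G := Eq0 (monus x y) Zero.

(* Strong majorizability x <=* y of Howard and Bezem. At type r ~> t it reads
   "for all v and all u <=* v, x u <=* y v and y u <=* y v", with #1 = v and
   #0 = u: the smaller argument u goes with the left-hand sides. *)
Fixpoint Maj s : forall G, tm G s -> tm G s -> fm G :=
  match s with
  | o => fun G x y => Le0 x y
  | r ~> t => fun G x y =>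
      All r (All r (Maj #0 #1 ⇒
        (Maj (twk r (twk r x) @ #0) (twk r (twk r y) @ #1)
         ∧ Maj (twk r (twk r y) @ #0) (twk r (twk r y) @ #1))))
  end.

(* Relativised quantifiers: [st] to standard objects, [m] to monotone ones,
   [mst] to monotone standard ones, [le b] to those majorized by b. *)
Definition All_st G s (A : fm (s :: G)) : fm G := All s (St #0 ⇒ A).
Definition Ex_st G s (A : fm (s :: G)) : fm G := Ex s (St #0 ∧ A).

Definition All_mst G s (A : fm (s :: G)) : fm G := All_st (Maj #0 #0 ⇒ A).
Definition Ex_mst G s (A : fm (s :: G)) : fm G := Ex_st (Maj #0 #0 ∧ A).

Definition All_le G s (b : tm G s) (A : fm (s :: G)) : fm G :=
  All s (Maj #0 (twk s b) ⇒ A).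
Definition Ex_le G s (b : tm G s) (A : fm (s :: G)) : fm G :=
  Ex s (Maj #0 (twk s b) ∧ A).
Definition Ex_mle G s (b : tm G s) (A : fm (s :: G)) : fm G :=
  Ex_le b (Maj #0 #0 ∧ A).

Arguments All_st {G} s A.
Arguments Ex_st {G} s A.
Arguments All_mst {G} s A.
Arguments Ex_mst {G} s A.

(* * Intuitionistic derivability *)

(* A set of axioms; the free variables of an axiom, listed in its context, are
   its parameters. *)
Definition axioms : Type := forall G : ctx, fm G -> Prop.

Definition union (T U : axioms) : axioms := fun G A => T G A \/ U G A.
Notation "T ⊕ U" := (union T U) (at level 50, left associativity) : ha_scope.

(* Natural deduction for many-sorted intuitionistic predicate logic: in
   [derives T G H A], the context G lists the eigenvariables in scope and H the
   open hypotheses. *)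
Inductive derives (T : axioms) : forall G : ctx, list (fm G) -> fm G -> Prop :=
| d_ax G (H : list (fm G)) A : T G A -> derives T H A
| d_hyp G (H : list (fm G)) A : In A H -> derives T H A
| d_botE G (H : list (fm G)) A : derives T H Bot -> derives T H A
| d_andI G (H : list (fm G)) A B :
    derives T H A -> derives T H B -> derives T H (A ∧ B)
| d_andE1 G (H : list (fm G)) A B : derives T H (A ∧ B) -> derives T H A
| d_andE2 G (H : list (fm G)) A B : derives T H (A ∧ B) -> derives T H B
| d_orI1 G (H : list (fm G)) A B : derives T H A -> derives T H (A ∨ B)
| d_orI2 G (H : list (fm G)) A B : derives T H B -> derives T H (A ∨ B)
| d_orE G (H : list (fm G)) A B C :
    derives T H (A ∨ B) -> derives T (A :: H) C -> derives T (B :: H) C ->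
    derives T H C
| d_impI G (H : list (fm G)) A B : derives T (A :: H) B -> derives T H (A ⇒ B)
| d_impE G (H : list (fm G)) A B :
    derives T H (A ⇒ B) -> derives T H A -> derives T H B
| d_allI G (H : list (fm G)) s (A : fm (s :: G)) :
    derives T (map (@fwk G s) H) A -> derives T H (All s A)
| d_allE G (H : list (fm G)) s (A : fm (s :: G)) (t : tm G s) :
    derives T H (All s A) -> derives T H (finst t A)
| d_exI G (H : list (fm G)) s (A : fm (s :: G)) (t : tm G s) :
    derives T H (finst t A) -> derives T H (Ex s A)
| d_exE G (H : list (fm G)) s (A : fm (s :: G)) (C : fm G) :
    derives T H (Ex s A) ->
    derives T (A :: map (@fwk G s) H) (fwk s C) -> derives T H C.

Definition inconsistent (T : axioms) : Prop :=
  derives T (@nil (fm [])) Bot.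

(* * E-HA^omega *)

(* The substitution n := n + 1 for the last variable. *)
Definition fnext G (A : fm (o :: G)) : fm (o :: G) :=
  fsub (scons (Succ @ #0) (sshift sid)) A.

Inductive EHA : axioms :=
| ha_refl G (x : tm G o) : EHA (Eq0 x x)
| ha_sym G (x y : tm G o) : EHA (Eq0 x y ⇒ Eq0 y x)
| ha_trans G (x y z : tm G o) : EHA (Eq0 x y ⇒ Eq0 y z ⇒ Eq0 x z)
| ha_succ0 G (x : tm G o) : EHA (Neg (Eq0 (Succ @ x) Zero))
| ha_succ_inj G (x y : tm G o) : EHA (Eq0 (Succ @ x) (Succ @ y) ⇒ Eq0 x y)
| ha_Pi G r t (x : tm G r) (y : tm G t) : EHA (Eq (Pi r t @ x @ y) x)
| ha_Sigma G d r t (x : tm G (d ~> r ~> t)) (y : tm G (d ~> r)) (z : tm G d) :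
    EHA (Eq (Sigma d r t @ x @ y @ z) (x @ z @ (y @ z)))
| ha_Rec0 G r (y : tm G r) (z : tm G (r ~> o ~> r)) :
    EHA (Eq (Rec r @ Zero @ y @ z) y)
| ha_RecS G r (x : tm G o) (y : tm G r) (z : tm G (r ~> o ~> r)) :
    EHA (Eq (Rec r @ (Succ @ x) @ y @ z) (z @ (Rec r @ x @ y @ z) @ x))
| ha_ind G (A : fm (o :: G)) :
    internal A = true ->
    EHA (finst Zero A ∧ All o (A ⇒ fnext A) ⇒ All o A)
| ha_ext G r t :
    EHA (All (r ~> t) (All r (All r
      (Eq #1 #0 ⇒ Eq (#2 @ #1) (#2 @ #0) : fm (r :: r :: (r ~> t) :: G))))).

(* * The Dinis-Gaspar system *)

(* In the schemes below, the variables of the matrix are the last ones of its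
   context: x, y are #1, #0 in A : fm (t :: s :: G). *)
Inductive DG : axioms :=
| dg_EHA G (A : fm G) : EHA A -> DG A
| dg_st_eq G s (x y : tm G s) : DG (Eq x y ⇒ (St x ⇒ St y))
| dg_st_maj G s (x y : tm G s) : DG (St y ⇒ (Maj x y ⇒ St x))
| dg_st_closed G s (t : tm [] s) : DG (St (tclosed G t))
| dg_st_app G s t (z : tm G (s ~> t)) (x : tm G s) :
    DG (St z ∧ St x ⇒ St (z @ x))
| dg_external_induction G (A : fm (o :: G)) :
    DG (finst Zero A ∧ All_st o (A ⇒ fnext A) ⇒ All_st o A)
| dg_monotone_choice G s t (A : fm (t :: s :: G)) :
    DG (All_mst s (Ex_mst t A) ⇒
        Ex_mst (s ~> t) (All_mst s (Ex_le (#1 @ #0) (fins2 (s ~> t) A))))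
| dg_realization G s t (A : fm (t :: s :: G)) :
    DG (All s (Ex_st t A) ⇒
        Ex_mst t (All s (Ex_le #1 (fins2 t A))))
| dg_idealisation G s t (A : fm (t :: s :: G)) :
    internal A = true ->
    DG (All_mst t (Ex s (All_le #1 (fins2 t A))) ⇒
        Ex s (All_st t A))
| dg_independence_of_premises G s t (A : fm (s :: G)) (B : fm (t :: G)) :
    internal A = true ->
    DG ((All_mst s A ⇒ Ex_mst t B) ⇒
        Ex_mst t (All_mst s (fins1 t A) ⇒ Ex_mle #0 (fins1 t B)))
| dg_markov G s (A : fm (s :: G)) (B : fm G) :
    internal A = true -> internal B = true ->
    DG ((All_mst s A ⇒ B) ⇒
        Ex_mst s (All_le #0 (fins1 s A) ⇒ fwk s B))
| dg_majorizability G s :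
    DG (All_st s (Ex_st s (Maj #1 #0 : fm (s :: s :: G)))).

(* * The additional principles *)

Fixpoint Exs (D : ctx) : fm D -> fm [] :=
  match D with
  | [] => fun A => A
  | s :: D' => fun A => Exs (Ex s A)
  end.

Fixpoint Exs_st (D : ctx) : fm D -> fm [] :=
  match D with
  | [] => fun A => A
  | s :: D' => fun A => Exs_st (Ex_st s A)
  end.

(* Parameter-freeness: the quantified variables are all of the context of A. *)
Inductive PF_TP_Ex : axioms :=
| pf_tp G (D : ctx) (A : fm D) :
    internal A = true ->
    PF_TP_Ex (fclosed G (Exs A ⇒ Exs_st A)).

Inductive QF_AC_2_0 : axioms :=
| qf_ac G (A : fm (o :: pure 2 :: G)) :
    quantifier_free A = true ->
    QF_AC_2_0
      (All (pure 2) (Ex o A) ⇒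
       Ex (pure 2 ~> o) (All (pure 2)
         (fsub (scons (#1 @ #0) (scons #0 (sshift (sshift sid)))) A))).

Inductive MP : axioms :=
| markov G :
    MP (All (pure 1)
      (Neg (Neg (Ex o (Eq0 (#1 @ #0) Zero))) ⇒ Ex o (Eq0 (#1 @ #0) Zero)
        : fm (pure 1 :: G))).

(* Main.v *)
(* Given Z of type 2, let F_Z n = Z (x |-> (n+1) - x) with truncated subtraction.
   If Z F_Z and Z 0 differ then, by extensionality, F_Z is not identically 0,
   so by Markov's principle F_Z n <> 0 for some n. QF-AC turns this into a
   functional finding such an n from Z, and parameter-free Transfer makes it a
   standard functional Phi. Let N be a number above all standard ones
   (idealisation) and Z g = sg (g N). This Z is majorized by the constant 1, so
   it is standard, although it depends on N; hence n = Phi Z is standard. But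
   F_Z n = sg ((n+1) - N) = 0, while F_Z N = 1 gives Z F_Z = 1 <> 0 = Z 0. *)

From Stdlib Require Import List.
Import ListNotations.
Require Import Defs.

Set Implicit Arguments.
Unset Strict Implicit.

(** * Substitution calculus for terms and equations *)

Lemma tsub_id G s (t : tm G s) : tsub sid t = t.
Proof. induction t; simpl; auto; now rewrite IHt1, IHt2. Qed.

Lemma tsub_tren G D E (g : renaming G D) (f : substitution D E) s (t : tm G s) :
  tsub f (tren g t) = tsub (fun r v => f r (g r v)) t.
Proof. induction t; simpl; auto; now rewrite IHt1, IHt2. Qed.

Lemma tren_tsub G D E (f : substitution G D) (g : renaming D E) s (t : tm G s) :
  tren g (tsub f t) = tsub (fun r v => tren g (f r v)) t.
Proof. induction t; simpl; auto; now rewrite IHt1, IHt2. Qed.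

Lemma tsub_sup_twk G D r (f : substitution G D) s (t : tm G s) :
  tsub (sup f) (twk r t) = twk r (tsub f t).
Proof. unfold twk; now rewrite tsub_tren, tren_tsub. Qed.

Lemma tsub_scons_twk G D r (a : tm D r) (f : substitution G D) s (t : tm G s) :
  tsub (scons a f) (twk r t) = tsub f t.
Proof. unfold twk; now rewrite tsub_tren. Qed.

Lemma tsub_sshift G D r (f : substitution G D) s (t : tm G s) :
  tsub (sshift f) t = twk r (tsub f t).
Proof. unfold twk; now rewrite tren_tsub. Qed.

Lemma sshiftE G D r (f : substitution G D) s (v : var G s) :
  sshift (r := r) f s v = twk r (f s v).
Proof. reflexivity. Qed.

Ltac simpl_tsub :=
  repeat first
    [ progress cbn [tsub scons sup sid]
    | rewrite sshiftE
    | rewrite tsub_sup_twk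
    | rewrite tsub_scons_twk
    | rewrite tsub_sshift
    | rewrite tsub_id ].

Lemma fsub_Eq s G D (f : substitution G D) (x y : tm G s) :
  fsub f (Eq x y) = Eq (tsub f x) (tsub f y).
Proof.
revert G D f x y; induction s as [|r _ t IH]; intros; simpl; auto.
now rewrite IH; simpl; rewrite !tsub_sup_twk.
Qed.

Lemma fwk_Eq r s G (x y : tm G s) : fwk r (Eq x y) = Eq (twk r x) (twk r y).
Proof. now unfold fwk; rewrite fsub_Eq, !tsub_sshift, !tsub_id. Qed.

Lemma finst_Eq r s G (a : tm G r) (x y : tm (r :: G) s) :
  finst a (Eq x y) = Eq (tsub (scons a sid) x) (tsub (scons a sid) y).
Proof. apply fsub_Eq. Qed.

(** * Combinatory completeness: bracket abstraction *)

Definition id_tm {G} (s : ty) : tm G (s ~> s) :=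
  Sigma s (s ~> s) s @ Pi s (s ~> s) @ Pi s s.

Definition lam_var G s t (v : var (s :: G) t) : tm G (s ~> t) :=
  match v in var G' t' return
    match G' with
    | [] => unit
    | s' :: G0 => tm G0 (s' ~> t')
    end
  with
  | vz => id_tm _
  | vs w => Pi _ _ @ Var w
  end.

Fixpoint lam G s t (b : tm (s :: G) t) : tm G (s ~> t) :=
  match b with
  | Var v => lam_var v
  | Zero => Pi _ _ @ Zero
  | Succ => Pi _ _ @ Succ
  | Pi r u => Pi _ _ @ Pi r u
  | Sigma d r u => Pi _ _ @ Sigma d r u
  | Rec r => Pi _ _ @ Rec r
  | App a c => Sigma _ _ _ @ lam a @ lam c
  end.

(** The context index of [v] is not a variable, so the return type of the match dispatches on the
    context. [P] is quantified inside the branch because its type mentions the head and tail of that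
    context. *)
Lemma var_case G r (P : forall s, var (r :: G) s -> Prop) :
  P r vz -> (forall s (w : var G s), P s (vs w)) ->
  forall s (v : var (r :: G) s), P s v.
Proof.
intros Pz Ps s v.
refine (match v as v' in var G' s' return
  match G' return var G' s' -> Prop with
  | [] => fun _ => True
  | r' :: G0 => fun v' => forall P' : (forall s, var (r' :: G0) s -> Prop),
      P' r' vz -> (forall s (w : var G0 s), P' s (vs w)) -> P' s' v'
  end v' with vz => _ | vs w => _ end P Pz Ps); auto.
Qed.

(** * Equality, beta-conversion and arithmetic over any extension of E-HA^omega *)

Section Extension.

(** Keeping [T] arbitrary lets these derivations be used directly in the full system, without
    transporting them from one axiom set to a larger one. *)
Context (T : axioms) (T_EHA : forall G (A : fm G), EHA A -> T G A).

Lemma Eq_ext r t G (H : list (fm G)) (x y : tm G (r ~> t)) :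
  derives T (map (@fwk G r) H) (Eq (twk r x @ #0) (twk r y @ #0)) ->
  derives T H (Eq x y).
Proof. exact (@d_allI _ _ _ _ _). Qed.

Lemma Eq_refl s G (H : list (fm G)) (x : tm G s) : derives T H (Eq x x).
Proof.
revert G H x; induction s as [|r _ t IH]; intros; simpl.
- apply d_ax, T_EHA, ha_refl.
- apply d_allI, IH.
Qed.

Lemma Eq_app_r r t G (H : list (fm G)) (x y : tm G (r ~> t)) (a : tm G r) :
  derives T H (Eq x y) -> derives T H (Eq (x @ a) (y @ a)).
Proof.
intros E; apply (d_allE a) in E; rewrite finst_Eq in E; simpl in E.
now rewrite !tsub_scons_twk, !tsub_id in E.
Qed.

(** The object-level implication puts the equation into the hypothesis list, where [d_allI] shifts
    it under the new eigenvariable. In rule form, the induction on types would call for weakening a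
    given derivation. *)
Lemma Eq_sym_imp s G (H : list (fm G)) (x y : tm G s) :
  derives T H (Eq x y ⇒ Eq y x).
Proof.
revert G H x y; induction s as [|r _ t IH]; intros.
- apply d_ax, T_EHA, ha_sym.
- apply d_impI, Eq_ext; cbn [map]; rewrite fwk_Eq.
  eapply d_impE; [apply IH|].
  apply Eq_app_r, d_hyp; now left.
Qed.

Lemma Eq_sym s G (H : list (fm G)) (x y : tm G s) :
  derives T H (Eq x y) -> derives T H (Eq y x).
Proof. apply d_impE, Eq_sym_imp. Qed.

Lemma Eq_trans_imp s G (H : list (fm G)) (x y z : tm G s) :
  derives T H (Eq x y ⇒ Eq y z ⇒ Eq x z).
Proof.
revert G H x y z; induction s as [|r _ t IH]; intros.
- apply d_ax, T_EHA, ha_trans.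
- apply d_impI, d_impI, Eq_ext; cbn [map]; rewrite !fwk_Eq.
  eapply d_impE; [eapply d_impE; [apply IH|]|];
    apply Eq_app_r, d_hyp; [right; now left | now left].
Qed.

Lemma Eq_trans s G (H : list (fm G)) (y x z : tm G s) :
  derives T H (Eq x y) -> derives T H (Eq y z) -> derives T H (Eq x z).
Proof.
intros E1 E2; exact (d_impE (d_impE (Eq_trans_imp _ _ _ _) E1) E2).
Qed.

(** The extensionality axiom (E) enters here. *)
Lemma Eq_app_l r t G (H : list (fm G)) (x : tm G (r ~> t)) (a b : tm G r) :
  derives T H (Eq a b) -> derives T H (Eq (x @ a) (x @ b)).
Proof.
assert (E : derives T H (All (r ~> t) (All r (All r
    (Eq #1 #0 ⇒ Eq (#2 @ #1) (#2 @ #0) : fm (r :: r :: (r ~> t) :: G)))))).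
{ apply d_ax, T_EHA, ha_ext. }
apply (d_allE x) in E; apply (d_allE a) in E; apply (d_allE b) in E.
revert E; unfold finst; cbn [fsub]; rewrite !fsub_Eq.
simpl_tsub; apply d_impE.
Qed.

Lemma Eq_app r t G (H : list (fm G)) (x y : tm G (r ~> t)) (a b : tm G r) :
  derives T H (Eq x y) -> derives T H (Eq a b) ->
  derives T H (Eq (x @ a) (y @ b)).
Proof.
intros E1 E2; apply Eq_trans with (x @ b).
- now apply Eq_app_l.
- now apply Eq_app_r.
Qed.

Lemma Pi_eq r t G (H : list (fm G)) (x : tm G r) (y : tm G t) :
  derives T H (Eq (Pi r t @ x @ y) x).
Proof. apply d_ax, T_EHA, ha_Pi. Qed.

Lemma Sigma_eq d r t G (H : list (fm G))
    (x : tm G (d ~> r ~> t)) (y : tm G (d ~> r)) (z : tm G d) :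
  derives T H (Eq (Sigma d r t @ x @ y @ z) (x @ z @ (y @ z))).
Proof. apply d_ax, T_EHA, ha_Sigma. Qed.

(* Stated under a substitution, because bracket abstraction does not commute
   syntactically with substitutions. *)
Lemma lam_beta_sub G D s t (b : tm (s :: G) t) (f : substitution G D)
    (H : list (fm D)) (a : tm D s) :
  derives T H (Eq (tsub f (lam b) @ a) (tsub (scons a f) b)).
Proof.
induction b; cbn [lam tsub]; try apply Pi_eq.
- revert s0 v; apply var_case; cbn [lam_var tsub].
  + eapply Eq_trans; [apply Sigma_eq | apply Pi_eq].
  + intros; apply Pi_eq.
- eapply Eq_trans; [apply Sigma_eq | now apply Eq_app].
Qed.

Lemma lam_beta G s t (b : tm (s :: G) t) (H : list (fm G)) (a : tm G s) :
  derives T H (Eq (lam b @ a) (tsub (scons a sid) b)).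
Proof.
rewrite <- (tsub_id (lam b)) at 1; apply lam_beta_sub.
Qed.

Lemma lam2_beta G s1 s2 t (b : tm (s2 :: s1 :: G) t) (H : list (fm G))
    (a1 : tm G s1) (a2 : tm G s2) :
  derives T H (Eq (lam (lam b) @ a1 @ a2) (tsub (scons a2 (scons a1 sid)) b)).
Proof.
eapply Eq_trans; [apply Eq_app_r, lam_beta | apply lam_beta_sub].
Qed.

Lemma derives_hyp0 G (H : list (fm G)) (A : fm G) : derives T (A :: H) A.
Proof. now apply d_hyp; left. Qed.

Lemma induction G (H : list (fm G)) (A : fm (o :: G)) (t : tm G o) :
  internal A = true ->
  derives T H (finst Zero A) ->
  derives T (A :: map (@fwk G o) H) (fnext A) ->
  derives T H (finst t A).
Proof.
intros iA D0 DS; apply d_allE.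
eapply d_impE; [apply d_ax, T_EHA, ha_ind, iA|].
apply d_andI; [easy | now apply d_allI, d_impI].
Qed.

(** * Case distinction and truncated subtraction *)

Definition one {G} : tm G o := Succ @ Zero.

Definition cond G (x y z : tm G o) : tm G o :=
  Rec o @ x @ y @ (Pi (o ~> o) o @ (Pi o o @ z)).

Lemma cond0 G (H : list (fm G)) (x y z : tm G o) :
  derives T H (Eq0 x Zero) -> derives T H (Eq0 (cond x y z) y).
Proof.
intros E; apply (@Eq_trans o) with (cond Zero y z).
- now apply Eq_app_r, Eq_app_r, Eq_app_l.
- apply d_ax, T_EHA, (@ha_Rec0 G o).
Qed.

Lemma condS G (H : list (fm G)) (x x' y z : tm G o) :
  derives T H (Eq0 x (Succ @ x')) -> derives T H (Eq0 (cond x y z) z).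
Proof.
intros E; apply (@Eq_trans o) with (cond (Succ @ x') y z).
- now apply Eq_app_r, Eq_app_r, Eq_app_l.
- eapply (@Eq_trans o); [apply d_ax, T_EHA, (@ha_RecS G o)|].
  eapply (@Eq_trans o); [apply Eq_app_r, Pi_eq | apply Pi_eq].
Qed.

Lemma cond_neq0 G (H : list (fm G)) (x y z : tm G o) :
  derives T H (Neg (Eq0 x Zero)) -> derives T H (Eq0 (cond x y z) z).
Proof.
intros N; refine (d_impE _ N).
(* The hypothesis names no predecessor of [x]. Induction on [x] supplies one: the zero case is
   absurd, and in the successor case [cond] computes. *)
pose (A := Neg (Eq0 #0 Zero) ⇒ Eq0 (cond #0 (twk o y) (twk o z)) (twk o z)).
enough (D : derives T H (finst x A)).
{ revert D; unfold finst, A, Neg, cond; cbn [fsub]; simpl_tsub; auto. }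
apply induction; [easy| |]; unfold finst, fnext, A, Neg; cbn [fsub].
- apply d_impI, d_botE.
  eapply d_impE; [apply derives_hyp0 | apply d_ax, T_EHA, ha_refl].
- apply d_impI; unfold cond; simpl_tsub.
  apply (condS (x' := #0)), d_ax, T_EHA, ha_refl.
Qed.

Lemma eq0_dec G (H : list (fm G)) (x : tm G o) :
  derives T H (Eq0 x Zero ∨ Neg (Eq0 x Zero)).
Proof.
pose (A := Eq0 #0 Zero ∨ Neg (Eq0 #0 Zero) : fm (o :: G)).
change (derives T H (finst x A)).
apply induction; [easy| |].
- apply d_orI1, d_ax, T_EHA, ha_refl.
- apply d_orI2, d_ax, T_EHA, ha_succ0.
Qed.

Lemma pred_eq G (H : list (fm G)) (x : tm G o) :
  derives T H (Eq (pred_tm @ x) (Rec o @ x @ Zero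
    @ (Pi (o ~> o) o @ (Sigma o (o ~> o) o @ Pi o (o ~> o) @ Pi o o)))).
Proof.
eapply Eq_trans; [apply Sigma_eq|].
apply Eq_app; [eapply Eq_trans; [apply Sigma_eq|] | apply Pi_eq].
apply Eq_app_l, Pi_eq.
Qed.

Lemma pred0 G (H : list (fm G)) : derives T H (Eq (pred_tm @ Zero) Zero).
Proof. eapply Eq_trans; [apply pred_eq | apply d_ax, T_EHA, ha_Rec0]. Qed.

Lemma predS G (H : list (fm G)) (x : tm G o) :
  derives T H (Eq (pred_tm @ (Succ @ x)) x).
Proof.
eapply Eq_trans; [apply pred_eq|].
eapply Eq_trans; [apply d_ax, T_EHA, ha_RecS|].
eapply Eq_trans; [apply Eq_app_r, Pi_eq|].
eapply Eq_trans; [apply Sigma_eq | apply Pi_eq].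
Qed.

Lemma monus0 G (H : list (fm G)) (x : tm G o) :
  derives T H (Eq (monus x Zero) x).
Proof. apply d_ax, T_EHA, ha_Rec0. Qed.

Lemma monusS G (H : list (fm G)) (x y : tm G o) :
  derives T H (Eq (monus x (Succ @ y)) (pred_tm @ monus x y)).
Proof.
eapply Eq_trans; [apply d_ax, T_EHA, ha_RecS|].
eapply Eq_trans; [apply Eq_app_r, Sigma_eq|].
eapply Eq_trans; [apply Eq_app_r, Eq_app_r, Pi_eq|].
apply Pi_eq.
Qed.

Lemma monus_congr G (H : list (fm G)) (x x' y y' : tm G o) :
  derives T H (Eq x x') -> derives T H (Eq y y') ->
  derives T H (Eq (monus x y) (monus x' y')).
Proof.
intros Ex Ey; apply Eq_app_r, Eq_app; [now apply Eq_app_l | easy].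
Qed.

(** [monus] recurses on its second argument, so the induction is on [y]: each step takes the
    predecessor of both sides. *)
Lemma monusSS G (H : list (fm G)) (x y : tm G o) :
  derives T H (Eq (monus (Succ @ x) (Succ @ y)) (monus x y)).
Proof.
pose (A := Eq0 (monus (Succ @ twk o x) (Succ @ #0)) (monus (twk o x) #0)).
enough (D : derives T H (finst y A)).
{ revert D; unfold finst, A, monus; cbn [fsub]; simpl_tsub; auto. }
apply induction; [easy| |]; unfold finst, fnext, A; cbn [fsub].
- change (derives T H (Eq (monus (Succ @ tsub (scons Zero sid) (twk o x)) one)
    (monus (tsub (scons Zero sid) (twk o x)) Zero))).
  eapply Eq_trans; [apply monusS|].
  eapply Eq_trans; [apply Eq_app_l, monus0|].
  eapply Eq_trans; [apply predS|].
  apply Eq_sym, monus0.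
- unfold monus; simpl_tsub.
  change (derives T (A :: map (@fwk G o) H)
    (Eq (monus (Succ @ twk o x) (Succ @ (Succ @ #0)))
        (monus (twk o x) (Succ @ #0)))).
  eapply Eq_trans; [apply monusS|].
  eapply Eq_trans; [apply Eq_app_l, (derives_hyp0 _ A)|].
  apply Eq_sym, monusS.
Qed.

Lemma monus_diag G (H : list (fm G)) (x : tm G o) :
  derives T H (Eq (monus x x) Zero).
Proof.
pose (A := Eq0 (monus #0 #0) Zero : fm (o :: G)).
change (derives T H (finst x A)).
apply induction; [easy | apply monus0 |].
eapply (@Eq_trans o); [apply monusSS | apply derives_hyp0].
Qed.

Lemma monus_succ_diag G (H : list (fm G)) (x : tm G o) :
  derives T H (Eq (monus (Succ @ x) x) one).
Proof.
pose (A := Eq0 (monus (Succ @ #0) #0) one : fm (o :: G)).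
change (derives T H (finst x A)).
apply induction; [easy | apply monus0 |].
eapply (@Eq_trans o); [apply monusSS | apply derives_hyp0].
Qed.

End Extension.

(** * The closed functionals behind the contradiction *)

Definition zero_fn {G} : tm G (pure 1) := Pi o o @ Zero.

(** [ramp @ n] is positive up to n and zero from n + 1 on, so its value at a fixed N separates N <=
    n from n < N. *)
Definition ramp {G} : tm G (o ~> pure 1) :=
  lam (lam (monus (Succ @ #1) #0 : tm (o :: o :: G) o)).

(** [trace @ Z] is the function F_Z. *)
Definition trace {G} : tm G (pure 2 ~> pure 1) :=
  lam (lam ((#1 : tm (o :: pure 2 :: G) (pure 1 ~> o)) @ (ramp @ #0))).

(** [search @ Z @ n] vanishes iff F_Z n <> 0 or Z F_Z <= Z 0. Coding this disjunction as an equation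
    f(n) = 0 gives it the shape that Markov's principle requires and makes it quantifier-free for
    choice. The one-sided comparison suffices because the final Z has Z F_Z = 1 and Z 0 = 0. *)
Definition search {G} : tm G (pure 2 ~> pure 1) :=
  lam (lam (cond (trace @ #1 @ #0)
    (monus ((#1 : tm (o :: pure 2 :: G) (pure 1 ~> o)) @ (trace @ #1))
           ((#1 : tm (o :: pure 2 :: G) (pure 1 ~> o)) @ zero_fn))
    Zero)).

Definition sign_at {G} : tm G (o ~> pure 2) :=
  lam (lam (cond ((#0 : tm (pure 1 :: o :: G) (o ~> o)) @ #1) Zero one)).

(** * Properties of the search and of the sign functional *)

Section Search.

Context (T : axioms) (T_EHA : forall G (A : fm G), EHA A -> T G A).

Lemma ramp_eq G (H : list (fm G)) (n x : tm G o) :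
  derives T H (Eq (ramp @ n @ x) (monus (Succ @ n) x)).
Proof. exact (lam2_beta T_EHA (monus (Succ @ #1) #0) _ n x). Qed.

Lemma trace_eq G (H : list (fm G)) (Z : tm G (pure 2)) (n : tm G o) :
  derives T H (Eq (trace @ Z @ n) ((Z : tm G (pure 1 ~> o)) @ (ramp @ n))).
Proof.
exact (lam2_beta T_EHA ((#1 : tm (o :: pure 2 :: G) (pure 1 ~> o)) @ (ramp @ #0)) _ Z n).
Qed.

Lemma search_eq G (H : list (fm G)) (Z : tm G (pure 2)) (n : tm G o) :
  derives T H (Eq (search @ Z @ n)
    (cond (trace @ Z @ n)
       (monus ((Z : tm G (pure 1 ~> o)) @ (trace @ Z))
              ((Z : tm G (pure 1 ~> o)) @ zero_fn)) Zero)).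
Proof.
refine (lam2_beta T_EHA (cond (trace @ #1 @ #0)
    (monus ((#1 : tm (o :: pure 2 :: G) (pure 1 ~> o)) @ (trace @ #1))
           ((#1 : tm (o :: pure 2 :: G) (pure 1 ~> o)) @ zero_fn))
    Zero) _ Z n).
Qed.

Lemma sign_at_eq G (H : list (fm G)) (n : tm G o) (g : tm G (pure 1)) :
  derives T H (Eq ((sign_at @ n : tm G (pure 1 ~> o)) @ g)
                  (cond ((g : tm G (o ~> o)) @ n) Zero one)).
Proof.
exact (lam2_beta T_EHA
  (cond ((#0 : tm (pure 1 :: o :: G) (o ~> o)) @ #1) Zero one) _ n g).
Qed.

Definition found G (Z : tm G (pure 2)) : fm G :=
  Ex o (Eq0 (search @ twk o Z @ #0) Zero).

Lemma foundI G (H : list (fm G)) (Z : tm G (pure 2)) (n : tm G o) :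
  derives T H (Eq (search @ Z @ n) Zero) -> derives T H (found Z).
Proof.
intros D; apply d_exI with n.
change (derives T H (Eq0 (search @ tsub (scons n sid) (twk o Z) @ n) Zero)).
now simpl_tsub.
Qed.

Lemma fwk_found G r (Z : tm G (pure 2)) : fwk r (found Z) = found (twk r Z).
Proof.
change (Ex o (Eq0 (search @ tsub (sup (sshift sid)) (twk o Z) @ #0) Zero)
        = found (twk r Z)).
now simpl_tsub.
Qed.

(* If the search never succeeded, [trace @ Z] would be the zero function, so by
   extensionality [Z @ (trace @ Z)] and [Z @ zero_fn] would agree and the search
   would succeed at zero. *)
Lemma not_not_found G (H : list (fm G)) (Z : tm G (pure 2)) :
  derives T H (Neg (Neg (found Z))).
Proof.
apply d_impI; set (N := Neg (found Z)).
assert (E : derives T (N :: H) (Eq (trace @ Z) zero_fn)).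
{ apply Eq_ext; cbn [map].
  change (fwk o N) with (Neg (fwk o (found Z))); rewrite fwk_found.
  change (derives T (Neg (found (twk o Z)) :: map (@fwk G o) H)
    (Eq (trace @ twk o Z @ #0) (zero_fn @ #0))).
  eapply (Eq_trans T_EHA); [|apply (Eq_sym T_EHA), (Pi_eq T_EHA)].
  (* Equality with zero is decidable, and a nonzero value of the trace would make the search succeed
     there, against [N]. *)
  eapply d_orE; [apply (eq0_dec T_EHA _ (trace @ twk o Z @ #0))
    | apply derives_hyp0 |].
  apply d_botE; eapply d_impE; [apply d_hyp; right; now left|].
  apply foundI with #0.
  eapply (Eq_trans T_EHA); [apply search_eq|].
  apply (cond_neq0 T_EHA), derives_hyp0. }
eapply d_impE; [apply derives_hyp0|].
apply foundI with Zero.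
eapply (Eq_trans T_EHA); [apply search_eq|].
eapply (Eq_trans T_EHA (s := o)); [apply (cond0 T_EHA)|].
- eapply (Eq_trans T_EHA (s := o)); [exact (Eq_app_r Zero E)|].
  apply (Pi_eq T_EHA).
- eapply (Eq_trans T_EHA (s := o)); [|apply (monus_diag T_EHA)].
  apply (monus_congr T_EHA); [|apply (Eq_refl T_EHA)].
  now apply (Eq_app_l T_EHA).
Qed.

Lemma sign_at_zero G (H : list (fm G)) (n : tm G o) (g : tm G (pure 1)) :
  derives T H (Eq0 ((g : tm G (o ~> o)) @ n) Zero) ->
  derives T H (Eq0 ((sign_at @ n : tm G (pure 1 ~> o)) @ g) Zero).
Proof.
intros E; eapply (Eq_trans T_EHA (s := o)); [apply sign_at_eq|].
exact (cond0 T_EHA _ _ E).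
Qed.

Lemma sign_at_succ G (H : list (fm G)) (n x : tm G o) (g : tm G (pure 1)) :
  derives T H (Eq0 ((g : tm G (o ~> o)) @ n) (Succ @ x)) ->
  derives T H (Eq0 ((sign_at @ n : tm G (pure 1 ~> o)) @ g) one).
Proof.
intros E; eapply (Eq_trans T_EHA (s := o)); [apply sign_at_eq|].
exact (condS T_EHA _ _ E).
Qed.

Lemma sign_at_le_one G (H : list (fm G)) (n : tm G o) (g : tm G (pure 1)) :
  derives T H (Le0 ((sign_at @ n : tm G (pure 1 ~> o)) @ g) one).
Proof.
eapply (Eq_trans T_EHA (s := o)).
{ apply (monus_congr T_EHA); [apply sign_at_eq | apply (Eq_refl T_EHA)]. }
eapply d_orE; [apply (eq0_dec T_EHA _ ((g : tm G (o ~> o)) @ n))| |];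
  (eapply (Eq_trans T_EHA (s := o));
    [apply (monus_congr T_EHA); [|apply (Eq_refl T_EHA)]|]).
- apply (cond0 T_EHA), derives_hyp0.
- eapply (Eq_trans T_EHA (s := o)); [apply (monusS T_EHA)|].
  eapply (Eq_trans T_EHA (s := o)); [|apply (pred0 T_EHA)].
  apply (Eq_app_l T_EHA), (monus0 T_EHA).
- apply (cond_neq0 T_EHA), derives_hyp0.
- apply (monus_diag T_EHA).
Qed.

(* The trace of [sign_at @ N] vanishes at n, but not at N, and the zero function
   is sent to 0. *)
Lemma search_sign_at G (H : list (fm G)) (N n : tm G o) :
  derives T H (Le0 (Succ @ n) N) ->
  derives T H (Eq0 (search @ (sign_at @ N) @ n) one).
Proof.
intros L.
eapply (Eq_trans T_EHA (s := o)); [apply search_eq|].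
eapply (Eq_trans T_EHA (s := o)); [apply (cond0 T_EHA)|].
- eapply (Eq_trans T_EHA (s := o)); [apply trace_eq|].
  apply sign_at_zero.
  eapply (Eq_trans T_EHA (s := o)); [apply ramp_eq | exact L].
- eapply (Eq_trans T_EHA (s := o)); [|apply (monus0 T_EHA)].
  apply (monus_congr T_EHA).
  (* With Z = [sign_at @ N], the sign is evaluated twice: Z F_Z = sg (F_Z N), and F_Z N = sg ((N+1)
     - N) = sg 1. *)
  + apply sign_at_succ with Zero.
    eapply (Eq_trans T_EHA (s := o)); [apply trace_eq|].
    apply sign_at_succ with Zero.
    eapply (Eq_trans T_EHA (s := o)); [apply ramp_eq|].
    apply (monus_succ_diag T_EHA).
  + apply sign_at_zero; exact (Pi_eq T_EHA _ Zero N).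
Qed.

End Search.

(** * The contradiction in the full system *)

Definition system : axioms := DG ⊕ PF_TP_Ex ⊕ QF_AC_2_0 ⊕ MP.

Lemma system_EHA G (A : fm G) : EHA A -> system A.
Proof. now intros; do 3 left; apply dg_EHA. Qed.

Lemma d_DG G (H : list (fm G)) (A : fm G) : DG A -> derives system H A.
Proof. now intros; apply d_ax; do 3 left. Qed.

(** Markov's principle, applied to the function [search @ Z], removes the double negation. *)
Lemma search_total G (H : list (fm G)) :
  derives system H (All (pure 2) (Ex o (Eq0 (search @ #1 @ #0) Zero))).
Proof.
apply d_allI; refine (d_impE _ (not_not_found system_EHA _ #0)).
exact (d_allE (search @ #0) (d_ax _ (or_intror (markov _)))).
Qed.

(** This is the matrix produced by choice. As [search] is closed, the choice functional is the only
    free variable, so parameter-free Transfer applies. *)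
Definition search_bound {G} : fm (pure 2 ~> o :: G) :=
  All (pure 2) (Eq0 (search @ #0 @
    ((#1 : tm (pure 2 :: (pure 2 ~> o) :: G) (pure 2 ~> o)) @ #0)) Zero).

Lemma standard_search_bound :
  derives system (@nil (fm [])) (Ex_st (pure 2 ~> o) search_bound).
Proof.
refine (@d_impE _ [] [] (Ex _ search_bound) _ _ _).
- apply d_ax; left; left; right.
  exact (@pf_tp [] [pure 2 ~> o] search_bound eq_refl).
- refine (d_impE _ (search_total (@nil (fm [])))).
  apply d_ax; left; right.
  exact (@qf_ac [] (Eq0 (search @ #1 @ #0) Zero) eq_refl).
Qed.

Lemma nonstandard_number G (H : list (fm G)) :
  derives system H (Ex o (All_st o (Le0 #0 #1))).
Proof.
refine (d_impE (d_DG _ (@dg_idealisation G o o (Le0 #0 #1) eq_refl)) _).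
(* The bound z is itself the witness: at type 0 majorization is the order, so the premise on y is
   already the claim. *)
apply d_allI, d_impI, d_impI, (d_exI (t := #0)).
apply d_allI, d_impI, derives_hyp0.
Qed.

Lemma St_app G (H : list (fm G)) s t (z : tm G (s ~> t)) (x : tm G s) :
  derives system H (St z) -> derives system H (St x) ->
  derives system H (St (z @ x)).
Proof.
intros Dz Dx; eapply d_impE; [apply d_DG, dg_st_app | now apply d_andI].
Qed.

(** Even for nonstandard [n], the values stay below 1. The constant functional 1 is a closed term,
    hence standard, and standardness passes down along majorization. *)
Lemma St_sign_at G (H : list (fm G)) (n : tm G o) :
  derives system H (St (sign_at @ n)).
Proof.
eapply d_impE; [eapply d_impE|].
- exact (d_DG _ (dg_st_maj (s := pure 2) _ (Pi o (pure 1) @ one))).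
- exact (d_DG _ (dg_st_closed G (s := pure 2) (Pi o (pure 1) @ one))).
- apply d_allI, d_allI, d_impI, d_andI.
  + refine (Eq_trans system_EHA (s := o) _
      (sign_at_le_one system_EHA _ (twk _ (twk _ n)) #0)).
    apply (monus_congr system_EHA);
      [apply (Eq_refl system_EHA) | apply (Pi_eq system_EHA)].
  + refine (Eq_trans system_EHA (s := o) _ (monus_diag system_EHA _ one)).
    apply (monus_congr system_EHA); apply (Pi_eq system_EHA).
Qed.

Theorem theorem3p2 : inconsistent (DG ⊕ PF_TP_Ex ⊕ QF_AC_2_0 ⊕ MP).
Proof.
change (derives system (@nil (fm [])) Bot).
eapply d_exE; [exact standard_search_bound|].
eapply d_exE; [apply nonstandard_number|].
(* Here [#0] is the number above all standard ones and [#1] the standard choice functional. *)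
set (Z := sign_at @ #0 : tm [o; pure 2 ~> o] (pure 2)).
set (Phi := #1 : tm [o; pure 2 ~> o] (pure 2 ~> o)).
match goal with |- derives _ ?H0 _ => set (H := H0) end.
assert (U : derives system H (All_st o (Le0 #0 #1))) by apply derives_hyp0.
assert (B : derives system H (fwk o (St #0 ∧ search_bound)))
  by (apply d_hyp; right; now left).
assert (S : derives system H (St (Phi @ Z))).
{ apply St_app; [exact (d_andE1 B) | apply St_sign_at]. }
(* The bound is taken at the successor, again standard, because F_Z n = sg ((n+1) - N) vanishes only
   for n strictly below N. *)
assert (L : derives system H (Le0 (Succ @ (Phi @ Z)) #0)).
{ refine (d_impE (d_allE (Succ @ (Phi @ Z)) U) _).
  refine (St_app _ S).
  exact (d_DG _ (dg_st_closed _ Succ)). }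
(* The value of [search] at [Z] and [Phi @ Z] is 1 by computation and 0 by the choice of [Phi]. *)
refine (d_impE (d_ax _ (system_EHA (ha_succ0 Zero))) _).
eapply (Eq_trans system_EHA (s := o)).
- apply (Eq_sym system_EHA (s := o)), (search_sign_at system_EHA), L.
- exact (d_allE Z (d_andE2 B)).
Qed.
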